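(* Let $M$ be a connected binary matroid that has three skew circuits. Then $M$ has a series minor isomorphic to $M(G)$ for some graph $G\in\{L_1,L_2,L_3,L_4,L_5\}$, where these (multi)graphs are: $L_1$: vertices $a,b,c,d$; two parallel edges between $c$ and $a$, two parallel edges between $a$ and $b$, two parallel edges between $b$ and $d$, and one edge between $c$ and $d$ (7 edges). $L_2$: vertices $o,a,b,c$; two parallel edges between $o$ and each of $a$, $b$, $c$, one edge $ac$ and one edge $bc$ (8 edges). $L_3$: vertices $p,q,r,s,t$; edges $pq$, $qr$, $rp$, $rs$, $rt$, two parallel edges between $p$ and $s$, and two parallel edges between $q$ and $t$ (9 edges). $L_4$: vertices $a,b,c,d,x,y$; edges $ab$, $bc$, $cd$, $da$, $cx$, $dy$, two parallel edges between $a$ and $x$, and two parallel edges between $b$ and $y$ (10 edges). $L_5$: vertices $n,s,u,v,w$; two parallel edges between $s$ and each of $u$, $v$, $w$, and one edge between $n$ and each of $u$, $v$, $w$ (9 edges).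
   Context: For an integer $k\ge 2$, a matroid $M$ has $k$ skew circuits if it has circuits $C_1,\dots,C_k$ such that $M|(C_1\cup\dots\cup C_k)=(M|C_1)\oplus\dots\oplus(M|C_k)$. $M(G)$ is the cycle matroid of the graph $G$. A series contraction of $M$ is the contraction $M/f$ of an element $f$ for which there is $g$ with $\{f,g\}$ a cocircuit of $M$; a matroid $N$ is a series minor of $M$ if $N$ can be obtained from $M$ by a sequence of deletions and series contractions. *)

(* Defs.v *)
From HB Require Import structures.
From mathcomp Require Import all_boot all_order all_algebra.
Set Implicit Arguments. Unset Strict Implicit. Unset Printing Implicit Defensive.
Import GRing.Theory.

Record matroid (T : finType) := Matroid {
  ground : {set T};
  indep : {set T} -> Prop }.

Section MatroidDefs.
Variable T : finType.
Implicit Types (M : matroid T) (X Y C B : {set T}).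

Definition is_matroid M : Prop :=
  [/\ indep M set0,
      (forall X, indep M X -> X \subset ground M),
      (forall X Y, Y \subset X -> indep M X -> indep M Y) &
      (forall X Y, indep M X -> indep M Y -> #|X| < #|Y| ->
         exists2 e, e \in Y :\: X & indep M (e |: X))].

Definition circuit M C : Prop :=
  [/\ C \subset ground M, ~ indep M C & forall D : {set T}, D \proper C -> indep M D].

Definition basis M B : Prop :=
  indep M B /\ forall X, indep M X -> B \subset X -> X = B.

Definition dual M : matroid T :=
  Matroid (ground M)
    (fun Y => Y \subset ground M /\ exists B, basis M B /\ [disjoint Y & B]).

Definition cocircuit M C : Prop := circuit (dual M) C.

Definition restrict M X : matroid T :=
  Matroid (ground M :&: X) (fun Y => Y \subset X /\ indep M Y).

Definition delete M e : matroid T := restrict M (ground M :\ e).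

Definition contract M f : matroid T :=
  Matroid (ground M :\ f)
    (fun Y => [/\ f \notin Y, indep M Y & (indep M [set f] -> indep M (f |: Y))]).

Definition mconnected M : Prop :=
  forall x y, x \in ground M -> y \in ground M -> x != y ->
    exists C, [/\ circuit M C, x \in C & y \in C].

(* M has k skew circuits: M|(C_1 u ... u C_k) = (M|C_1) (+) ... (+) (M|C_k);
   the direct sum requires pairwise disjoint ground sets, and its independent
   sets are the Y whose traces on each C_i are independent. *)
Definition has_skew_circuits M (k : nat) : Prop :=
  exists C : 'I_k -> {set T},
    [/\ (forall i, circuit M (C i)),
        (forall i j, i != j -> [disjoint C i & C j]) &
        (forall Y, Y \subset \bigcup_i C i ->
           (indep M Y <-> forall i, indep M (Y :&: C i)))].

Definition binary M : Prop :=
  exists (n : nat) (phi : T -> 'rV['F_2]_n),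
    forall X, X \subset ground M -> (indep M X <-> free [seq phi x | x <- enum X]).

Inductive series_minor : matroid T -> matroid T -> Prop :=
| sm_refl M : series_minor M M
| sm_del M N e : e \in ground M -> series_minor (delete M e) N -> series_minor M N
| sm_con M N f g : cocircuit M [set f; g] -> series_minor (contract M f) N ->
                   series_minor M N.

End MatroidDefs.

Definition miso (T1 T2 : finType) (M : matroid T1) (N : matroid T2) : Prop :=
  exists phi : T1 -> T2,
    [/\ {in ground M &, injective phi},
        phi @: ground M = ground N &
        forall X : {set T1}, X \subset ground M -> (indep M X <-> indep N (phi @: X))].

Record mgraph := MGraph { nedges : nat; endpts : 'I_nedges -> nat * nat }.

Section Graphs.
Variable G : mgraph.
Implicit Types C : {set 'I_(nedges G)}.

Definition gdeg C (v : nat) : nat :=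
  #|[set e in C | (endpts e).1 == v]| + #|[set e in C | (endpts e).2 == v]|.

Definition share_vertex (e1 e2 : 'I_(nedges G)) : bool :=
  [|| (endpts e1).1 == (endpts e2).1, (endpts e1).1 == (endpts e2).2,
      (endpts e1).2 == (endpts e2).1 | (endpts e1).2 == (endpts e2).2].

Definition edge_connected C : Prop :=
  forall C1 : {set 'I_(nedges G)}, C1 \subset C -> C1 != set0 -> C1 != C ->
    exists e1 e2, [/\ e1 \in C1, e2 \in C :\: C1 & share_vertex e1 e2].

Definition gcycle C : Prop :=
  [/\ C != set0, (forall v, gdeg C v = 0 \/ gdeg C v = 2) & edge_connected C].

Definition cycle_matroid : matroid 'I_(nedges G) :=
  Matroid setT (fun X => forall C, C \subset X -> ~ gcycle C).
End Graphs.

Definition mkgraph (s : seq (nat * nat)) : mgraph :=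
  @MGraph (size s) (fun i => nth (0, 0) s i).

(* L1: a=0 b=1 c=2 d=3 *)
Definition L1 := mkgraph [:: (2,0); (2,0); (0,1); (0,1); (1,3); (1,3); (2,3)].
(* L2: o=0 a=1 b=2 c=3 *)
Definition L2 := mkgraph [:: (0,1); (0,1); (0,2); (0,2); (0,3); (0,3); (1,3); (2,3)].
(* L3: p=0 q=1 r=2 s=3 t=4 *)
Definition L3 := mkgraph [:: (0,1); (1,2); (2,0); (2,3); (2,4); (0,3); (0,3); (1,4); (1,4)].
(* L4: a=0 b=1 c=2 d=3 x=4 y=5 *)
Definition L4 := mkgraph [:: (0,1); (1,2); (2,3); (3,0); (2,4); (3,5);
                             (0,4); (0,4); (1,5); (1,5)].
(* L5: n=0 s=1 u=2 v=3 w=4 *)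
Definition L5 := mkgraph [:: (1,2); (1,2); (1,3); (1,3); (1,4); (1,4);
                             (0,2); (0,3); (0,4)].

(* Main.v *)
Require Import Defs.
From mathcomp Require Import all_boot all_order all_algebra.
Set Implicit Arguments. Unset Strict Implicit. Unset Printing Implicit Defensive.
Import GRing.Theory.

(** A binary matroid is handled through its cycle space, a family of sets closed under symmetric
difference: deletion keeps the cycles avoiding an element, and contracting one of two elements that
lie in the same cycles forgets it. If the cycles inside X are the sums of C_1, ..., C_k, each element
of X has a membership vector in F_2^k, and up to series contraction the restriction to X is
determined by the set of vectors that occur.

Let P and Q be disjoint and skew. In a connected matroid some cycle E, minimal outside P and Q, meets
both in sets that are not cycles; otherwise every cycle splits into two disjoint cycles, one avoiding
Q and one avoiding P, which is absurd for a circuit meeting P and Q. Apply this to C_1 and the union of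
C_2 and C_3. If the ear A so found splits all three circuits, the four cycles C_1, C_2, C_3, A give
L_1. Otherwise A splits C_1 and C_2, say, and can be taken disjoint from C_3; a second ear B joins C_3
to the union of C_1, C_2 and A. Outside the circuits the vectors in the coordinates (A, B) are then,
after replacing B by A + B if necessary, (1,0), (0,1) and possibly (1,1). Unless B or A + B splits
all three circuits and yields L_1, the pattern is that of L_2, L_3 or L_4 (according to the number of
vectors on C_1) when (1,1) is absent, and that of L_5 when it is present. *)

(** * Cycle spaces and series minors *)

Section CycleSpaces.
Variable T : finType.
Implicit Types (M N : matroid T) (W : {set {set T}}) (A X Y Z C D R : {set T}).

Definition sd X Y := [set x | (x \in X) (+) (x \in Y)].

Lemma in_sd X Y x : (x \in sd X Y) = (x \in X) (+) (x \in Y).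
Proof. exact: in_set. Qed.

Definition sd_closed W := set0 \in W /\ forall Y Z, Y \in W -> Z \in W -> sd Y Z \in W.

(** Stands for the kernel of a representation over F_2: its minimal nonempty members are the
    circuits, and its members are the disjoint unions of circuits. *)
Definition cycle_space M W : Prop :=
  [/\ sd_closed W, forall Y, Y \in W -> Y \subset ground M &
      forall X, indep M X <->
        X \subset ground M /\ forall Y, Y \in W -> Y \subset X -> Y = set0].

(** Over F_2 the coefficients of a linear relation are 0 or 1, so a relation amounts to a subset
    with zero sum. *)
Lemma free_setP n (phi : T -> 'rV['F_2]_n) X :
  free [seq phi x | x <- enum X] <->
  forall Y, Y \subset X -> (\sum_(y in Y) phi y = 0)%R -> Y = set0.
Proof.
have nthE (i : 'I_#|X|) : ([seq phi x | x <- enum X]`_i)%R = phi (enum_val i).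
  by rewrite (nth_map (enum_default i)) // -cardE.
have F2E (c : 'F_2) : (c != 0 -> c = 1)%R by case: c => [[|[|m]] ltm] // _; apply: val_inj.
have frP := @freeP _ _ _ (map_tuple phi (enum_tuple X)).
split=> [/frP frX Y sYX sumY0 | Xind].
  have /frX k0 : (\sum_(i < #|X|) ((enum_val i \in Y)%:R : 'F_2) *:
                  (map_tuple phi (enum_tuple X))`_i = 0)%R.
    transitivity (\sum_(x in X) ((x \in Y)%:R : 'F_2) *: phi x)%R.
      by rewrite [RHS]big_enum_val; apply: eq_bigr => i _; rewrite nthE.
    rewrite -[RHS]sumY0 [LHS]big_mkcond [RHS]big_mkcond; apply: eq_bigr => x _.
    case: (boolP (x \in Y)) => [/(subsetP sYX)->|_]; first by rewrite scale1r.
    by rewrite scale0r if_same.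
  apply/setP => x; rewrite inE; apply/negP => xY.
  have xX := subsetP sYX _ xY.
  have := k0 (enum_rank_in xX x).
  by rewrite enum_rankK_in // xY => /eqP; rewrite oner_eq0.
apply/frP => k sum0 i.
pose Y := [set enum_val j | j : 'I_#|X| & k j != 0%R].
have Y0 : Y = set0.
  apply: Xind; first by apply/subsetP => _ /imsetP[j _ ->]; apply: enum_valP.
  rewrite big_imset /=; last by move=> ? ? _ _; apply: enum_val_inj.
  rewrite -[RHS]sum0 big_mkcond; apply: eq_bigr => j _; rewrite nthE inE.
  by case: eqP => [->|/eqP/F2E->]; rewrite ?scale0r ?scale1r.
apply/eqP/negPn/negP => ki; have : enum_val i \in Y by apply: imset_f; rewrite inE.
by rewrite Y0 inE.
Qed.

(** The witness consists of the sets whose vectors sum to zero; in characteristic 2 the common part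
    of two such sets cancels, which gives closure. *)
Lemma binary_cycle_space M : is_matroid M -> binary M -> exists W, cycle_space M W.
Proof.
move=> [_ indM _ _] [n [phi phiP]].
exists [set Y : {set T} | (Y \subset ground M) && (\sum_(y in Y) phi y == 0)%R].
split; last 1 first.
- move=> X; split=> [iX|[sX Xind]].
    have sX := indM _ iX; split=> // Y; rewrite inE => /andP[_ /eqP sum0] sYX.
    by have /(phiP _ sX)/free_setP := iX; apply.
  apply/phiP=> //; apply/free_setP => Y sYX sum0; apply: Xind => //.
  by rewrite inE sum0 eqxx (subset_trans sYX).
- split=> [|Y Z]; first by rewrite inE sub0set big_set0 eqxx.
  rewrite !inE => /andP[sY /eqP sumY] /andP[sZ /eqP sumZ].
  have sYZ : sd Y Z \subset ground M.
    by apply/subsetP => x; rewrite in_sd; case: (boolP (x \in Y)) => [/(subsetP sY)|_ /(subsetP sZ)].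
  have add2 (v : 'rV['F_2]_n) : (v + v = 0)%R.
    by apply/rowP => i; rewrite !mxE -mulr2n -mulr_natl pchar_Zp ?mul0r.
  (* The zero on the right becomes the sum over [Y] plus the sum over [Z], and the two sides are
     compared term by term. *)
  rewrite sYZ /= big_mkcond -[X in _ == X](addr0) -[X in (X + _)%R]sumY -[X in (_ + X)%R]sumZ.
  rewrite (big_mkcond (fun y => y \in Y)) (big_mkcond (fun y => y \in Z)) -big_split.
  apply/eqP/eq_bigr => x _; rewrite in_sd.
  by case: (x \in Y); case: (x \in Z); rewrite /= ?addr0 ?add0r.
- by move=> Y; rewrite inE => /andP[].
Qed.

Lemma cycle_space_delete M W e :
  cycle_space M W -> cycle_space (delete M e) [set Y in W | e \notin Y].
Proof.
move=> [[W0 Wsd] Wg Wi]; have gE : ground (delete M e) = ground M :\ e.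
  by apply/setP => x; rewrite !inE; case: (x \in ground M); rewrite ?andbF.
split=> [|Y|X]; rewrite ?gE.
- split=> [|Y Z]; rewrite !inE ?W0 // => /andP[YW eY] /andP[ZW eZ].
  by rewrite Wsd //= (negPf eY) (negPf eZ).
- by rewrite inE subsetD1 => /andP[/Wg-> ->].
- split=> [[sX /Wi[_ Xi]]|[sX Xi]]; split=> //.
    by move=> Y; rewrite inE => /andP[YW _]; apply: Xi.
  apply/Wi; split; first exact: subset_trans sX (subD1set _ _).
  move=> Y YW sYX; apply: Xi => //; rewrite inE YW.
  by apply/negP => /(subsetP sYX)/(subsetP sX); rewrite !inE eqxx.
Qed.

(** A cycle inside {f} misses [g], hence also [f]. So [f] is not a loop, and no nonempty cycle
    becomes empty when [f] is removed. *)
Lemma cycle_space_contract M W f g :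
  cycle_space M W -> f != g -> (forall Y, Y \in W -> (f \in Y) = (g \in Y)) ->
  f \in ground M ->
  cycle_space (contract M f) [set Y :\ f | Y in W].
Proof.
move=> [[W0 Wsd] Wg Wi] fg ser fM.
have if1 : indep M [set f].
  apply/Wi; split=> [|Y YW sY]; first by rewrite sub1set.
  have gY : g \notin Y by apply: contra fg => /(subsetP sY); rewrite inE eq_sym.
  apply/setP => x; rewrite inE; apply/negP => xY; have := subsetP sY _ xY.
  by rewrite inE => /eqP xf; move: gY; rewrite -ser // -xf xY.
split=> [|Y|X].
- split=> [|_ _ /imsetP[Y YW ->] /imsetP[Z ZW ->]].
    by apply/imsetP; exists set0; rewrite ?set0D.
  apply/imsetP; exists (sd Y Z); first exact: Wsd.
  by apply/setP => x; rewrite !(in_sd, in_setD1); case: (x == f).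
- by move=> /imsetP[Z ZW ->]; apply: setSD; apply: Wg.
- split=> [[fX /Wi[sX _] /(_ if1)/Wi[_ Xi]]|[sX Xi]].
    split; first by rewrite subsetD1 sX.
    move=> _ /imsetP[Y YW ->] sYX; rewrite (Xi _ YW) ?set0D //.
    by rewrite -subDset.
  have fX : f \notin X by apply/negP => /(subsetP sX); rewrite !inE eqxx.
  have iX : indep M (f |: X).
    apply/Wi; split; first by rewrite subUset sub1set fM (subset_trans sX (subD1set _ _)).
    move=> Y YW sY; have Y0 : Y :\ f = set0 by apply: Xi; [apply: imset_f | rewrite subDset].
    have gY : g \notin Y.
      by apply/negP => gY; have := in_set0 g; rewrite -Y0 !inE eq_sym fg gY.
    apply/setP => x; rewrite inE; apply/negP => xY; have := in_set0 x.
    rewrite -Y0 !inE xY andbT => /negbFE/eqP xf.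
    by move: gY; rewrite -ser // -xf xY.
  split=> //; apply/Wi; split; first exact: subset_trans sX (subD1set _ _).
  by move=> Y YW sY; have /Wi[_] := iX; apply=> //; apply: subset_trans sY (subsetUr _ _).
Qed.

(** Take [C] inclusion-minimal among the cycles through [f]: adding to it a nonempty cycle inside C
    - f would give a smaller one. *)
Lemma cycle_minimal W f D : sd_closed W -> D \in W -> f \in D ->
  exists2 C, C \in W & f \in C /\ forall Y, Y \in W -> Y \subset C :\ f -> Y = set0.
Proof.
move=> [W0 Wsd] DW fD.
have [C /minsetP[/andP[CW fC] Cmin] _] :=
  @minset_exists _ (fun C : {set T} => (C \in W) && (f \in C)) D (introT andP (conj DW fD)).
exists C => //; split=> // Y YW; rewrite subsetD1 => /andP[sYC fY].
have : sd C Y = C.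
  apply: Cmin; first by rewrite Wsd // in_sd fC (negPf fY).
  by apply/subsetP => x; rewrite in_sd; case: (boolP (x \in Y)) => [/(subsetP sYC)->|]; rewrite ?addbF.
move=> e; apply/setP => x; have := in_sd C Y x; rewrite e inE.
by case: (x \in C); case: (x \in Y).
Qed.

(** A basis avoiding both elements could be enlarged by [f], since a new cycle would contain [f] and
    therefore [g]. Conversely an element [e] on a cycle is avoided by any basis that extends C - e,
    for a minimal cycle [C] through [e]. *)
Lemma cocircuit_series M W f g : cycle_space M W -> f != g ->
  (forall Y, Y \in W -> (f \in Y) = (g \in Y)) ->
  (exists2 Y, Y \in W & f \in Y) -> cocircuit M [set f; g].
Proof.
move=> MW fg ser [D0 D0W fD0]; have [Wsd Wg Wi] := MW.
have gD0 : g \in D0 by rewrite -ser.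
(* A boolean form of independence, as required for the existence of maximal sets. *)
pose ib X := (X \subset ground M) && [forall Y in W, (Y \subset X) ==> (Y == set0)].
have iP X : reflect (indep M X) (ib X).
  apply: (iffP andP) => [[sX /forall_inP Xi]|/Wi[sX Xi]]; [apply/Wi|]; split=> //.
    by move=> Y YW sY; apply/eqP/(implyP (Xi Y YW)).
  by apply/forall_inP => Y YW; apply/implyP => sY; apply/eqP/Xi.
have basisE X : indep M X -> exists2 B, basis M B & X \subset B.
  move=> /iP iX; have [B /maxsetP[/iP iB Bmax] sXB] := @maxset_exists _ ib _ iX.
  by exists B => //; split=> // Y /iP iY sBY; apply: Bmax.
have avoid e : e \in D0 -> exists2 B, basis M B & e \notin B.
  move=> eD0; have [C CW [eC Ci]] := cycle_minimal Wsd D0W eD0.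
  have [|B bB sCB] := basisE (C :\ e).
    by apply/Wi; split=> //; apply: subset_trans (subD1set _ _) (Wg _ CW).
  exists B => //; apply/negP => eB; have [/Wi[_ Bi] _] := bB.
  have C0 : C = set0 by apply: Bi => //; rewrite -(setD1K eC) subUset sub1set eB.
  by rewrite C0 inE in eC.
have sg : [set f; g] \subset ground M by rewrite subUset !sub1set !(subsetP (Wg _ D0W)).
split=> // [[_ [B [[/[dup] iB /Wi[sB Bi] Bmax]]]]|D].
  rewrite disjoints_subset subUset !sub1set !inE => /andP[fB gB].
  have : ~ indep M (f |: B).
    by move=> /Bmax/(_ (subsetUr _ _))/setP/(_ f); rewrite !inE eqxx (negPf fB).
  apply; apply/Wi; split; first by rewrite subUset sB sub1set (subsetP (Wg _ D0W)).
  move=> Y YW sY; apply: Bi => //; apply/subsetP => x xY; have := subsetP sY _ xY.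
  rewrite !inE => /orP[/eqP xf|//]; move: xY; rewrite xf ser // => /(subsetP sY).
  by rewrite !inE eq_sym (negPf fg) (negPf gB).
move=> /properP[sD [e ein eD]]; split; first exact: subset_trans sD sg.
(* A proper subset of the pair lies in a singleton, which some basis avoids. *)
have [d dD0 sDd] : exists2 d, d \in D0 & D \subset [set d].
  move: ein; rewrite !inE => /orP[] /eqP ee; [exists g | exists f] => //;
  apply/subsetP => x xD; have := subsetP sD _ xD; rewrite !inE => /orP[]// /eqP xx;
  by rewrite xx -ee in xD; rewrite xD in eD.
have [B bB dB] := avoid _ dD0; exists B; split=> //.
by rewrite (disjointWl sDd) // disjoints1.
Qed.

(** The elements outside [X] are deleted one by one. The last clause speaks of all minors of [N]
    because [series_minor] adds its steps at the front. *)
Lemma series_minor_restrict M W X : cycle_space M W -> X \subset ground M ->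
  exists N, [/\ ground N = X, cycle_space N [set Y in W | Y \subset X] &
    forall N', series_minor N N' -> series_minor M N'].
Proof.
have [n] := ubnP #|ground M :\: X|; elim: n M W => // n IHn M W ltn MW sX.
case: (set_0Vmem (ground M :\: X)) => [/eqP|[e]].
  rewrite setD_eq0 => sM; exists M; split=> //; first by apply/eqP; rewrite eqEsubset sM.
  have [_ Wg _] := MW; suff -> : [set Y in W | Y \subset X] = W by [].
  by apply/setP => Y; rewrite inE andb_idr // => /Wg sY; apply: subset_trans sY sM.
rewrite inE => /andP[eX eM].
have gE : ground (delete M e) = ground M :\ e.
  by apply/setP => x; rewrite !inE; case: (x \in ground M); rewrite ?andbF.
have [||N [gN NW sN]] := IHn _ _ _ (cycle_space_delete e MW).
- rewrite gE setDDl setUC -setDDl (cardsD1 e) in ltn *.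
  by rewrite inE eX eM in ltn.
- by rewrite gE subsetD1 sX.
exists N; split=> // [|N' /sN]; last exact: sm_del.
suff -> : [set Y in W | Y \subset X] =
  [set Y in [set Y in W | e \notin Y] | Y \subset X] by [].
apply/setP => Y; rewrite !inE; case: (Y \in W) => //=.
case: (boolP (Y \subset X)) => [sY|]; rewrite ?andbF ?andbT //.
by apply/esym/negP => /(subsetP sY); apply/negP.
Qed.

(** An element [f] outside [R] and its partner in [R] lie in the same cycles, and some cycle
    contains [f]; so they form a cocircuit and [f] can be contracted. Both hypotheses survive the
    contraction. *)
Lemma series_minor_cosimplify M W R : cycle_space M W -> R \subset ground M ->
  (forall x, x \in ground M -> exists2 r, r \in R &
     forall Y, Y \in W -> (x \in Y) = (r \in Y)) ->
  (forall x, x \in ground M -> exists2 Y, Y \in W & x \in Y) ->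
  exists N, [/\ ground N = R, cycle_space N [set Y :&: R | Y in W] & series_minor M N].
Proof.
have [n] := ubnP #|ground M :\: R|; elim: n M W => // n IHn M W ltn MW sR ser cov.
have [_ Wg _] := MW.
case: (set_0Vmem (ground M :\: R)) => [/eqP|[f]].
  rewrite setD_eq0 => sM; exists M; split; last exact: sm_refl.
    by apply/eqP; rewrite eqEsubset sM.
  suff -> : [set Y :&: R | Y in W] = W by [].
  apply/setP => Y; apply/imsetP/idP => [[Z ZW ->]|YW].
    by rewrite (setIidPl _) // (subset_trans (Wg _ ZW)).
  by exists Y; rewrite ?(setIidPl _) // (subset_trans (Wg _ YW)).
rewrite inE => /andP[fR fM]; have [g gR fser] := ser _ fM.
have fg : f != g by apply: contraNneq fR => ->.
have [||||N [gN NW sN]] := IHn _ _ _ (cycle_space_contract MW fg fser fM).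
- rewrite /= setDDl setUC -setDDl (cardsD1 f) in ltn *.
  by rewrite inE fR fM in ltn.
- by rewrite /= subsetD1 sR.
- move=> x; rewrite !inE => /andP[xf xM]; have [r rR xser] := ser _ xM; exists r => //.
  move=> _ /imsetP[Y YW ->]; rewrite !inE xf (xser _ YW).
  by have -> : r != f by apply: contraNneq fR => <-.
- move=> x; rewrite !inE => /andP[xf xM]; have [Y YW xY] := cov _ xM.
  by exists (Y :\ f); [apply: imset_f | rewrite !inE xf].
exists N; split=> //; last by apply: sm_con sN; apply: cocircuit_series MW fg fser (cov _ fM).
suff -> : [set Y :&: R | Y in W] = [set Y :&: R | Y in [set Y :\ f | Y in W]] by [].
rewrite -imset_comp; apply: eq_imset => Y /=; apply/setP => x; rewrite !inE.
by case: (eqVneq x f) => [->|]; rewrite ?(negPf fR) ?andbF.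
Qed.

Definition scale (b : bool) A := if b then A else set0.

Lemma in_scale b A x : (x \in scale b A) = b && (x \in A).
Proof. by case: b; rewrite ?inE. Qed.

Lemma scaleW W b A : set0 \in W -> A \in W -> scale b A \in W.
Proof. by case: b. Qed.

Lemma mem_sub X Y x : X \subset Y -> (x \in X) ==> (x \in Y).
Proof. by move/subsetP => sXY; apply/implyP/sXY. Qed.

Lemma mem_eq X Y x : X = Y -> (x \in X) = (x \in Y).
Proof. by move->. Qed.

Lemma mem_disjoint X Y x : [disjoint X & Y] -> ~~ ((x \in X) && (x \in Y)).
Proof. by case: (boolP (x \in X)) => //= xX /disjointFr->. Qed.

End CycleSpaces.

(** Set identities are decided pointwise by truth tables: the facts needed are first moved into the
    goal in the boolean forms of [mem_sub], [mem_eq] and [mem_disjoint]. *)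
Ltac membership x :=
  rewrite ?(in_sd, in_scale, inE) //=;
  repeat match goal with |- context [x \in ?S] => case: (x \in S) => //= end; done.

(** The inner product over F_2; the surplus of the longer list is ignored. *)
Fixpoint dot (l v : bitseq) : bool :=
  if (l, v) is (a :: l', b :: v') then (a && b) (+) dot l' v' else false.

(** * Graphs given by membership vectors *)

Section GraphCoordinates.
Implicit Types (s : seq (nat * nat)) (m l v : bitseq) (vecs : seq bitseq) (u : nat).

Fixpoint bitseqs n : seq bitseq :=
  if n is n'.+1 then [seq b :: m | b <- [:: true; false], m <- bitseqs n'] else [:: [::]].

Lemma mem_bitseqs n m : (m \in bitseqs n) = (size m == n).
Proof.
elim: n m => [|n IHn] m; first by rewrite inE; case: m.
apply/allpairsP/eqP => [[[b m'] /= [_ + ->]]|]; first by rewrite IHn => /eqP /= ->.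
by case: m => // b m [sm]; exists (b, m); rewrite IHn sm !inE; case: b.
Qed.

Definition degree s m u :=
  sumn [seq nat_of_bool p.1 * ((p.2.1 == u) + (p.2.2 == u)) | p <- zip m s].

Definition two_regular s m :=
  all (fun u => degree s m u \in [:: 0; 2]) (undup (map fst s ++ map snd s)).

Definition coords vecs l := [seq dot l v | v <- vecs].

Definition submask m1 m2 := all (fun p => p.1 ==> p.2) (zip m1 m2).

(* The cycle space of the graph with edge list [s] consists of the sets of edges [e] with
   [dot l v_e = true], for [l] of length [k]; [vecs] lists the [v_e] in the order of [s]. For the
   second half it is enough that each such nonempty set contains a 2-regular one. *)
Definition has_coords k s vecs :=
  [&& size vecs == size s, 0 < size s, uniq vecs,
      all (fun v => (size v == k) && has id v) vecs,
      all (fun m => two_regular s m && has id m ==>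
             has (fun l => m == coords vecs l) (bitseqs k)) (bitseqs (size s)) &
      all (fun l => has id (coords vecs l) ==>
             has (fun l' => [&& has id (coords vecs l'),
                                submask (coords vecs l') (coords vecs l) &
                                two_regular s (coords vecs l')]) (bitseqs k))
          (bitseqs k)].

Definition bits n (C : {set 'I_n}) := [seq i \in C | i <- enum 'I_n].

Lemma size_bits n (C : {set 'I_n}) : size (bits C) = n.
Proof. by rewrite size_map size_enum_ord. Qed.

Lemma nth_bits n (C : {set 'I_n}) (i : 'I_n) : nth false (bits C) i = (i \in C).
Proof. by rewrite (nth_map i) ?size_enum_ord // nth_ord_enum. Qed.

Lemma has_bits n (C : {set 'I_n}) : has id (bits C) = (C != set0).
Proof.
rewrite has_map; apply/hasP/set0Pn => [[i _ iC]|[i iC]]; exists i => //.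
by rewrite mem_enum.
Qed.

Lemma bits_set n m : size m = n -> bits [set i : 'I_n | nth false m i] = m.
Proof.
move=> sm; apply: (@eq_from_nth _ false); rewrite size_bits // => i ltin.
by rewrite (nth_bits _ (Ordinal ltin)) inE.
Qed.

Lemma gdeg_degree s (C : {set 'I_(nedges (mkgraph s))}) u :
  gdeg C u = degree s (bits C) u.
Proof.
have sE : s = [seq nth (0, 0) s (nat_of_ord i) | i <- enum 'I_(size s)].
  by rewrite (map_comp (nth _ s)) val_enum_ord -/(mkseq _ _) mkseq_nth.
have zE : zip (bits C) s = [seq (i \in C, nth (0, 0) s (nat_of_ord i)) | i <- enum 'I_(size s)].
  by rewrite -zip_map; congr zip; exact: sE.
rewrite /degree zE -map_comp sumnE big_map big_enum /=.
rewrite /gdeg -!sum1_card.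
rewrite (big_mkcond (fun i => i \in [set e in C | _])) [X in _ + X = _]big_mkcond -big_split /=.
apply: eq_bigr => i _; rewrite !inE.
by case: (i \in C) => //=; rewrite mul1n; case: eqP; case: eqP.
Qed.

Lemma degree_notin s m u : u \notin map fst s ++ map snd s -> degree s m u = 0.
Proof.
rewrite mem_cat negb_or /degree.
elim: s m => [|e s IHs] [|b m] //=; rewrite !inE !negb_or.
move=> /andP[/andP[e1 u1] /andP[e2 u2]]; rewrite IHs ?u1 //.
by rewrite ![_ == u]eq_sym (negPf e1) (negPf e2) muln0.
Qed.

Lemma two_regularP s (C : {set 'I_(nedges (mkgraph s))}) :
  reflect (forall u, gdeg C u = 0 \/ gdeg C u = 2) (two_regular s (bits C)).
Proof.
apply: (iffP allP) => [dC u|dC u _]; rewrite ?gdeg_degree.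
  case: (boolP (u \in undup (map fst s ++ map snd s))) => [/dC|]; last first.
    by rewrite mem_undup => /degree_notin->; left.
  by rewrite !inE => /orP[] /eqP->; [left | right].
by have := dC u; rewrite gdeg_degree !inE => -[] ->.
Qed.

(** A minimal nonempty 2-regular set is connected: if no edge of [C1] touches the rest of [C], then
    at each vertex [C1] has all the edges of [C] or none, so [C1] is itself 2-regular. *)
Lemma two_regular_gcycle s (D : {set 'I_(nedges (mkgraph s))}) :
  two_regular s (bits D) -> D != set0 ->
  exists2 C : {set 'I_(nedges (mkgraph s))}, C \subset D & gcycle C.
Proof.
move=> rD D0.
pose P (C : {set 'I_(nedges (mkgraph s))}) := two_regular s (bits C) && (C != set0).
have [|C /minsetP[/andP[rC C0] Cmin] sCD] := @minset_exists _ P D; first by rewrite /P rD.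
exists C => //; split=> //; first exact/two_regularP.
move=> C1 sC1 C1n0 C1C.
have [/existsP[e1 /existsP[e2 /and3P[? ? ?]]]|noe] := boolP [exists e1 : 'I_(nedges (mkgraph s)),
  exists e2 : 'I_(nedges (mkgraph s)), [&& e1 \in C1, e2 \in C :\: C1 & share_vertex e1 e2]].
  by exists e1, e2.
have noshare e1 e2 : e1 \in C1 -> e2 \in C -> share_vertex e1 e2 -> e2 \in C1.
  move=> eC1 eC sh; apply/negPn/negP => e2C1; case/negP: noe.
  by apply/existsP; exists e1; apply/existsP; exists e2; rewrite inE eC1 eC e2C1.
case/eqP: C1C; apply: Cmin => //; rewrite /P C1n0 andbT; apply/two_regularP => u.
pose inc (e : 'I_(nedges (mkgraph s))) := ((endpts e).1 == u) || ((endpts e).2 == u).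
case: (boolP [exists e in C1, inc e]) => [/exists_inP[e eC1 ie]|/exists_inPn noinc]; last first.
  left; rewrite /gdeg; apply/eqP; rewrite addn_eq0 !cards_eq0; apply/andP; split;
  by apply/eqP/setP => e; rewrite !inE; apply/negP => /andP[/noinc/norP[/negPf h1 /negPf h2]]; rewrite ?h1 ?h2.
suff -> : gdeg C1 u = gdeg C u by apply/two_regularP.
rewrite /gdeg; congr (_ + _); apply: eq_card => f; rewrite !inE.
  apply/andP/andP => -[fC fu]; split=> //; first exact: (subsetP sC1).
  apply: noshare eC1 fC _; rewrite /share_vertex (eqP fu).
  by case/orP: ie => ->; rewrite ?orbT.
apply/andP/andP => -[fC fu]; split=> //; first exact: (subsetP sC1).
apply: noshare eC1 fC _; rewrite /share_vertex (eqP fu).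
by case/orP: ie => ->; rewrite ?orbT.
Qed.

(** A graph cycle is 2-regular, hence a combination; a nonempty combination contains a nonempty
    2-regular set, hence a graph cycle. So avoiding the ones is the same as avoiding the others. *)
Lemma cycle_matroid_coords k s vecs X : has_coords k s vecs ->
  indep (cycle_matroid (mkgraph s)) X <->
  forall l, size l = k ->
    [set i : 'I_(nedges (mkgraph s)) | dot l (nth [::] vecs i)] \subset X ->
    [set i : 'I_(nedges (mkgraph s)) | dot l (nth [::] vecs i)] = set0.
Proof.
move=> /and5P[/eqP sv _ _ _ /andP[/allP ck1 /allP ck2]].
pose Y l := [set i : 'I_(nedges (mkgraph s)) | dot l (nth [::] vecs i)].
have bitsY l : bits (Y l) = coords vecs l.
  rewrite -[RHS](@bits_set (size s)) ?size_map //; congr bits; apply/setP => i.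
  by rewrite !inE (nth_map [::]) // sv.
split=> [Xi l sl sYX|Xi C sCX [C0 C2 _]].
  apply/eqP/negPn/negP => Y0; have := ck2 l; rewrite mem_bitseqs sl eqxx => /(_ isT).
  rewrite -bitsY has_bits Y0 /= => /hasP[l' _]; rewrite -bitsY has_bits => /and3P[Y'0 sub r].
  have [C sCY gC] := two_regular_gcycle r Y'0.
  apply: (Xi C) gC; apply: subset_trans sYX; apply: subset_trans sCY _.
  apply/subsetP => i iY; have /allP/(_ (i \in Y l', i \in Y l)) := sub.
  rewrite iY /=; apply.
  rewrite /bits zip_map; apply/mapP; exists i; rewrite ?mem_enum ?iY //.
have := ck1 (bits C); rewrite has_bits C0 andbT mem_bitseqs size_bits eqxx => /(_ isT).
have -> /= : two_regular s (bits C) by apply/two_regularP.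
move=> /hasP[l lk /eqP]; rewrite -bitsY => CE.
have {}CE : C = Y l.
  by apply/setP => i; rewrite -!nth_bits CE.
have sl : size l = k by apply/eqP; rewrite -mem_bitseqs.
by move/eqP: C0; apply; rewrite CE; apply: Xi => //; rewrite -/(Y l) -CE.
Qed.

End GraphCoordinates.

(** * Graphs as series minors, read off from membership vectors *)

Section Realize.
Variable T : finType.
Implicit Types (M N : matroid T) (W : {set {set T}}) (B : seq {set T}).

Definition mem_vec B (x : T) : bitseq := [seq x \in C | C : {set T} <- B].

(** The linear combination over F_2 of the members of [B] with coefficients [l]. *)
Definition comb B l : {set T} := [set x | dot l (mem_vec B x)].

(** Restrict to the union of the members of [B]. Elements with equal vectors then lie in the same
    cycles, so series contractions leave one element for each vector, and these elements correspond
    to the edges. *)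
Lemma series_minor_graph M W B k s vecs :
  cycle_space M W -> has_coords k s vecs ->
  (forall l, size l = k -> comb B l \in W) ->
  (forall Y, Y \in W -> (forall x, x \in Y -> has id (mem_vec B x)) ->
     exists2 l, size l = k & Y = comb B l) ->
  (forall x, has id (mem_vec B x) -> mem_vec B x \in vecs) ->
  (forall v, v \in vecs -> exists x, mem_vec B x = v) ->
  exists N, series_minor M N /\ miso N (cycle_matroid (mkgraph s)).
Proof.
move=> MW hc combW Wcomb Xvecs vecsX; have [_ Wg _] := MW.
have /and5P[/eqP sv s0 uv /allP vk _] := hc.
pose X := [set x | has id (mem_vec B x)].
have combX l : comb B l \subset X.
  apply/subsetP => x; rewrite !inE; elim: (mem_vec B x) l => [|b v IHv] [|a l] //=.
  by case: b => //; rewrite andbF; apply: IHv.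
have cov x : x \in X -> exists2 l, size l = k & x \in comb B l.
  rewrite inE => xX; have /andP[/eqP + _] := vk _ (Xvecs _ xX).
  (* The coefficient list is the unit vector at the first true entry of the vector. *)
  suff : forall v, has id v -> exists2 l, size l = size v & dot l v.
    by move=> /(_ _ xX)[l sl dl] <-; exists l; rewrite ?inE.
  elim=> // b v IHv; case: b => /= [_|/IHv[l sl dl]]; last by exists (false :: l); rewrite /= ?sl.
  exists (true :: nseq (size v) false); rewrite /= ?size_nseq //.
  by elim: v {IHv} => //= b v; case: (dot _ _).
have sXM : X \subset ground M.
  by apply/subsetP => x /cov[l sl]; apply/subsetP/Wg/combW.
have [N1 [gN1 N1W sN1]] := series_minor_restrict MW sXM.
(* [choose] returns the same representative for all elements with the same vector. *)
pose rep x := choose (fun y => mem_vec B y == mem_vec B x) x.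
have repE x : mem_vec B (rep x) = mem_vec B x.
  by apply/eqP; apply: (@chooseP _ (fun y => mem_vec B y == mem_vec B x)).
have repK x y : mem_vec B x = mem_vec B y -> rep x = rep y.
  by move=> e; rewrite /rep e; apply: choose_id; rewrite ?e.
have repX x : (rep x \in X) = (x \in X) by rewrite !inE repE.
pose R := rep @: X.
have RX : R \subset X by apply/subsetP => _ /imsetP[x xX ->]; rewrite repX.
have [|x|x|N [gN NW sN]] := series_minor_cosimplify (R := R) N1W; rewrite ?gN1 //.
- move=> xX; exists (rep x); first exact: imset_f.
  move=> Y; rewrite inE => /andP[YW sYX]; have [|l _ ->] := Wcomb _ YW.
    by move=> y /(subsetP sYX); rewrite inE.
  by rewrite !inE repE.
- move=> /cov[l sl xl]; exists (comb B l) => //; rewrite inE combX andbT; exact: combW.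
exists N; split; first exact: sN1.
(* The default edge is reached only outside [X], where the vector is not in [vecs]. *)
pose phi x : 'I_(nedges (mkgraph s)) := insubd (Ordinal s0) (index (mem_vec B x) vecs).
have phiE x : x \in X -> nth [::] vecs (phi x) = mem_vec B x.
  rewrite inE => /Xvecs xv; have lti : index (mem_vec B x) vecs < size s by rewrite -sv index_mem.
  by rewrite val_insubd lti nth_index.
have phi_inj : {in R &, injective phi}.
  move=> _ _ /imsetP[x xX ->] /imsetP[y yX ->] e; apply: repK.
  by rewrite -repE -[RHS]repE -!phiE ?repX // e.
have phiR (i : 'I_(nedges (mkgraph s))) : exists2 x, x \in R & phi x = i.
  have iv : nth [::] vecs i \in vecs by rewrite mem_nth // sv.
  have [x xi] := vecsX _ iv; have /andP[_ xX] := vk _ iv.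
  have {}xX : x \in X by rewrite inE xi.
  exists (rep x); first exact: imset_f.
  apply: val_inj; rewrite val_insubd repE xi index_uniq ?sv //.
  by rewrite (ltn_ord i).
have combE l : [set i : 'I_(nedges (mkgraph s)) | dot l (nth [::] vecs i)] =
    phi @: (comb B l :&: R).
  apply/setP => i; rewrite inE; apply/idP/imsetP => [|[x]].
    have [x xR <-] := phiR i => di; exists x => //.
    by rewrite !inE xR andbT -phiE // (subsetP RX).
  by rewrite !inE => /andP[dx xR ->]; rewrite phiE // (subsetP RX).
exists phi; rewrite gN; split=> //.
  by apply/setP => i; rewrite inE; have [x xR <-] := phiR i; apply: imset_f.
have [_ _ Ni] := NW.
move=> S sSR; split=> [/Ni[_ Si]|Si].
  apply/(cycle_matroid_coords _ hc) => l sl; rewrite combE => sub.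
  apply/eqP; rewrite imset_eq0; apply/eqP/Si.
    by apply/imsetP; exists (comb B l); rewrite // inE combX andbT; apply: combW.
  apply/subsetP => x xC; have /imsetP[y yS e] := subsetP sub _ (imset_f phi xC).
  rewrite (phi_inj x y _ _ e) //; last exact: (subsetP sSR).
  by move: xC; rewrite inE => /andP[].
move/(cycle_matroid_coords _ hc) in Si; apply/Ni; rewrite gN; split=> // Y' /imsetP[Y].
rewrite inE => /andP[YW sYX] -> sub; have [|l sl YE] := Wcomb _ YW.
  by move=> y /(subsetP sYX); rewrite inE.
have : phi @: (Y :&: R) = set0 by rewrite YE -combE; apply: Si; rewrite // combE -YE imsetS.
by move/eqP; rewrite imset_eq0 => /eqP.
Qed.

End Realize.

(** * Edge vectors of the five graphs *)

Section Coordinates.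
Local Notation o := false.
Local Notation i := true.
Implicit Type p : bool * bool.

(* Coordinates are the three skew circuits followed by the ears: the vectors of elements of the
   first, second and third circuit and of elements outside them, [p] telling membership in the ears. *)
Definition in1 p := [:: i; o; o; p.1; p.2].
Definition in2 p := [:: o; i; o; p.1; p.2].
Definition in3 p := [:: o; o; i; p.1; p.2].
Definition out p := [:: o; o; o; p.1; p.2].

Definition L1_coords := [:: [:: i; o; o; o]; [:: i; o; o; i]; [:: o; i; o; o]; [:: o; i; o; i];
  [:: o; o; i; o]; [:: o; o; i; i]; [:: o; o; o; i]].
(** In [L2_coords], [L3_coords] and [L4_coords] the first circuit carries two, three and four
    vectors. For [L2] these are [p] and its opposite; for [L3] the opposite of [p] is the missing
    one. *)
Definition L2_coords p := [:: in2 (o, o); in2 (i, o); in3 (o, o); in3 (o, i);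
  in1 p; in1 (~~ p.1, ~~ p.2); out (i, o); out (o, i)].
Definition L3_coords p := [:: in1 p; in1 (p.1, ~~ p.2); in1 (~~ p.1, p.2);
  out (i, o); out (o, i); in2 (o, o); in2 (i, o); in3 (o, o); in3 (o, i)].
Definition L4_coords := [:: in1 (i, o); in1 (i, i); in1 (o, i); in1 (o, o);
  out (i, o); out (o, i); in2 (o, o); in2 (i, o); in3 (o, o); in3 (o, i)].
(** The pattern is symmetric in the ears [A], [B] and A + B: each splits two of the circuits, and
    they miss the third, the first and the second circuit respectively. *)
Definition L5_coords := [:: in1 (o, o); in1 (i, o); in2 (o, o); in2 (i, i); in3 (o, o); in3 (o, i);
  out (i, o); out (i, i); out (o, i)].

Lemma L1_has_coords :
  has_coords 4 [:: (2,0); (2,0); (0,1); (0,1); (1,3); (1,3); (2,3)] L1_coords.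
Proof. by vm_compute. Qed.

Lemma L2_has_coords p : has_coords 5
  [:: (0,1); (0,1); (0,2); (0,2); (0,3); (0,3); (1,3); (2,3)] (L2_coords p).
Proof. by case: p => [[] []]; vm_compute. Qed.

Lemma L3_has_coords p : has_coords 5
  [:: (0,1); (1,2); (2,0); (2,3); (2,4); (0,3); (0,3); (1,4); (1,4)] (L3_coords p).
Proof. by case: p => [[] []]; vm_compute. Qed.

Lemma L4_has_coords : has_coords 5
  [:: (0,1); (1,2); (2,3); (3,0); (2,4); (3,5); (0,4); (0,4); (1,5); (1,5)] L4_coords.
Proof. by vm_compute. Qed.

Lemma L5_has_coords : has_coords 5
  [:: (1,2); (1,2); (1,3); (1,3); (1,4); (1,4); (0,2); (0,3); (0,4)] L5_coords.
Proof. by vm_compute. Qed.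

End Coordinates.

(** * Ears of skew circuits *)

Section Ears.
Variable T : finType.
Implicit Types (M N : matroid T) (W : {set {set T}}) (X Y Z C D P Q A B : {set T}).

(** Up to cycles inside [Z], [D] is the only further cycle within the union of [Z] and [D]. The ear
    may itself meet [Z]. *)
Definition ear W Z D :=
  D \in W /\ forall Y, Y \in W -> Y \subset Z :|: D -> Y \subset Z \/ sd Y D \subset Z.

(** Induction on the part of [D] outside [P] and [Q]. If [D] is not an ear, some cycle [Y] makes
    both [Y] and D + Y smaller there, and splittings of these two add up to one of [D]. If [D] is an
    ear with a cycle as trace on [P] or [Q], cutting off that trace splits it. *)
Lemma ear_or_split W P Q D : sd_closed W -> [disjoint P & Q] ->
  (forall Y, Y \in W -> Y \subset P :|: Q -> Y :&: P \in W) -> D \in W ->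
  (exists E, [/\ ear W (P :|: Q) E, E :&: P \notin W & E :&: Q \notin W]) \/
  exists D1 D2, [/\ D1 \in W /\ D2 \in W, D1 :&: D2 = set0, D1 :|: D2 = D,
                    D1 :&: Q = set0 & D2 :&: P = set0].
Proof.
move=> [W0 Wsd] dPQ skew.
have dis x := mem_disjoint x dPQ.
have splitP D' : D' \in W -> D' :&: P \in W -> exists D1 D2,
    [/\ D1 \in W /\ D2 \in W, D1 :&: D2 = set0, D1 :|: D2 = D',
        D1 :&: Q = set0 & D2 :&: P = set0].
  move=> D'W DPW; exists (D' :&: P), (sd D' (D' :&: P)).
  split; first (by split=> //; apply: Wsd); apply/setP => x; have := dis x; membership x.
have [n] := ubnP #|D :\: (P :|: Q)|; elim: n D => // n IHn D ltn DW.
have [sD|nsD] := boolP (D \subset P :|: Q); first by right; apply: splitP => //; apply: skew.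
have [/exists_inP[Y YW /and3P[sY nY nYD]]|noY] := boolP [exists Y in W,
    [&& Y \subset P :|: Q :|: D, ~~ (Y \subset P :|: Q) & ~~ (sd Y D \subset P :|: Q)]].
  have {}sY x := mem_sub x sY.
  have ltY : #|Y :\: (P :|: Q)| < n.
    rewrite -ltnS; apply: leq_trans ltn; rewrite ltnS; apply: proper_card; apply/properP; split.
      by apply/subsetP => x; have := sY x; membership x.
    by have /subsetPn[x p1 p2] := nYD; exists x; move: (sY x) p1 p2; membership x.
  have ltDY : #|sd D Y :\: (P :|: Q)| < n.
    rewrite -ltnS; apply: leq_trans ltn; rewrite ltnS; apply: proper_card; apply/properP; split.
      by apply/subsetP => x; have := sY x; membership x.
    by have /subsetPn[x p1 p2] := nY; exists x; move: (sY x) p1 p2; membership x.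
  have [|[Y1 [Y2 [[Y1W Y2W] Y12 YE Y1Q Y2P]]]] := IHn Y ltY YW; first by left.
  have [|[X1 [X2 [[X1W X2W] X12 XE X1Q X2P]]]] := IHn _ ltDY (Wsd _ _ DW YW); first by left.
  right.
  (* Outside [P] and [Q] the cycles [Y] and D + Y are disjoint, while [X2], [Y2] miss [P] and [X1],
     [Y1] miss [Q]; hence the sums are disjoint with union [D]. *)
  exists (sd X1 Y1), (sd X2 Y2); split; first (by split; apply: Wsd); apply/setP => x;
  move: (sY x) (dis x) (mem_eq x XE) (mem_eq x YE) (mem_eq x X12) (mem_eq x Y12)
    (mem_eq x X1Q) (mem_eq x Y1Q) (mem_eq x X2P) (mem_eq x Y2P); membership x.
have earD : ear W (P :|: Q) D.
  split=> // Y YW sY; move/exists_inPn/(_ _ YW): noY; rewrite sY /=.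
  by case: (Y \subset _); [left | case: (sd Y D \subset _) => //; right].
have [DPW|nP] := boolP (D :&: P \in W); first by right; apply: splitP.
have [DQW|nQ] := boolP (D :&: Q \in W); last by left; exists D.
right; exists (sd D (D :&: Q)), (D :&: Q).
split; first (by split=> //; apply: Wsd); apply/setP => x; have := dis x; membership x.
Qed.

Definition min_cycle W C :=
  [/\ C \in W, C != set0 & forall Y, Y \in W -> Y \subset C -> Y = set0 \/ Y = C].

Lemma circuit_min_cycle M W C : cycle_space M W -> circuit M C -> min_cycle W C.
Proof.
move=> [[W0 _] Wg Wi] [sC dC iC].
have propC Y : Y \in W -> Y \subset C -> Y = set0 \/ Y = C.
  move=> YW sYC; have [|] := eqVneq Y C; [by right | move=> nYC; left].
  have /iC/Wi[_ Yi] : Y \proper C by rewrite properEneq nYC.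
  exact: Yi.
have C0 : C != set0.
  by apply/eqP => C0; apply: dC; apply/Wi; split=> // Y _; rewrite C0 subset0 => /eqP.
split=> //; apply/negPn/negP => nCW; apply: dC; apply/Wi; split=> // Y YW sYC.
by have [//|YC] := propC _ YW sYC; rewrite -YC YW in nCW.
Qed.

(** Start from a circuit through a point of [P] and a point of [Q]. Minimality makes one part of a
    splitting empty, so the circuit would miss [P] or [Q]. *)
Lemma connected_ear M W P Q : cycle_space M W -> mconnected M -> [disjoint P & Q] ->
  (forall Y, Y \in W -> Y \subset P :|: Q -> Y :&: P \in W) ->
  P \subset ground M -> Q \subset ground M -> P != set0 -> Q != set0 ->
  exists E, [/\ ear W (P :|: Q) E, E :&: P \notin W & E :&: Q \notin W].
Proof.
move=> MW conn dPQ skew PM QM /set0Pn[x xP] /set0Pn[y yQ].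
have [Wsd _ _] := MW.
have xy : x != y by apply: contraTneq yQ => <-; rewrite (disjointFr dPQ xP).
have [K [Kc xK yK]] := conn x y (subsetP PM _ xP) (subsetP QM _ yQ) xy.
have [KW _ Kmin] := circuit_min_cycle MW Kc.
have [//|[D1 [D2 [[D1W _] D12 DE D1Q D2P]]]] := ear_or_split Wsd dPQ skew KW.
have [||DD] := Kmin D1 D1W; first by rewrite -DE subsetUl.
  move=> D10; have /setP/(_ x) := D2P; have /setP/(_ x) := DE.
  by rewrite !inE D10 inE xP xK /= => ->.
by have /setP/(_ y) := D1Q; rewrite !inE DD yK yQ.
Qed.

(** Disjointness is a pointwise count, a form that truth tables can use and that is symmetric in the
    circuits. *)
Definition skew_triple W C1 C2 C3 :=
  [/\ min_cycle W C1, min_cycle W C2, min_cycle W C3,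
      (forall x, (x \in C1) + (x \in C2) + (x \in C3) <= 1) &
      forall Y, Y \in W -> Y \subset C1 :|: C2 :|: C3 ->
        [/\ Y :&: C1 \in W, Y :&: C2 \in W & Y :&: C3 \in W]].

Lemma skew_triple_swap12 W C1 C2 C3 : skew_triple W C1 C2 C3 -> skew_triple W C2 C1 C3.
Proof.
move=> [m1 m2 m3 dis span]; split=> // [x|Y YW]; first by have := dis x; membership x.
by rewrite (setUC C2) => /(span _ YW)[].
Qed.

Lemma skew_triple_swap23 W C1 C2 C3 : skew_triple W C1 C2 C3 -> skew_triple W C1 C3 C2.
Proof.
move=> [m1 m2 m3 dis span]; split=> // [x|Y YW]; first by have := dis x; membership x.
by rewrite setUAC => /(span _ YW)[].
Qed.

(** Add to [Y] every circuit it contains. The resulting cycle [Y'] contains none of the circuits, so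
    its traces are independent; by skewness [Y'] is independent, hence empty. Each trace of [Y] is
    therefore empty or a whole circuit. *)
Lemma has_skew_triple M W : cycle_space M W -> has_skew_circuits M 3 ->
  exists C1 C2 C3, skew_triple W C1 C2 C3.
Proof.
move=> MW [C [Cc Cd Ci]]; have Cm i := circuit_min_cycle MW (Cc i).
have [[W0 Wsd] Wg Wi] := MW.
have dis x i j : x \in C i -> x \in C j -> i = j.
  move=> xi xj; apply/eqP/negPn/negP => /Cd/disjointFr/(_ xi).
  by rewrite xj.
exists (C ord0), (C (inord 1)), (C (inord 2)).
have ordE (i : 'I_3) : [\/ i = ord0, i = inord 1 | i = inord 2].
  by case: i => [[|[|[|]]] lti] //; [constructor 1 | constructor 2 | constructor 3];
    apply: val_inj; rewrite /= ?inordK.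
split=> // [x|].
  have n01 : ord0 != inord 1 :> 'I_3 by rewrite -val_eqE /= inordK.
  have n02 : ord0 != inord 2 :> 'I_3 by rewrite -val_eqE /= inordK.
  have n12 : inord 1 != inord 2 :> 'I_3 by rewrite -val_eqE /= !inordK.
  by move: (mem_disjoint x (Cd _ _ n01)) (mem_disjoint x (Cd _ _ n02))
    (mem_disjoint x (Cd _ _ n12)); membership x.
move=> Y YW sY.
pose c (j : 'I_3) := C j \subset Y.
pose Y' := sd Y (sd (scale (c ord0) (C ord0))
  (sd (scale (c (inord 1)) (C (inord 1))) (scale (c (inord 2)) (C (inord 2))))).
have CW j : C j \in W by case: (Cm j).
have Y'W : Y' \in W by apply: (Wsd) => //; apply: (Wsd); [|apply: (Wsd)]; apply: scaleW.
have inY' x j : x \in C j -> (x \in Y') = ~~ c j && (x \in Y).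
  move=> xj; have cx k : (x \in C k) = (k == j).
    by apply/idP/eqP => [xk|->//]; apply: dis xk xj.
  have xY : c j -> x \in Y by move/subsetP; apply.
  rewrite !(in_sd, in_scale) !cx; case: (ordE j) xY => ->;
  rewrite -!val_eqE /= !inordK //=; case: (c ord0); case: (c (inord 1)); case: (c (inord 2));
  by case: (x \in Y) => //= /(_ isT).
have sY' : Y' \subset \bigcup_i C i.
  apply/subsetP => x xY'; suff [j xj] : exists j, x \in C j by apply/bigcupP; exists j.
  move: xY' (subsetP sY x); rewrite !(in_sd, in_scale, inE).
  have [xc|_] := boolP (x \in C ord0); first by exists ord0.
  have [xc|_] := boolP (x \in C (inord 1)); first by exists (inord 1).
  have [xc|_] := boolP (x \in C (inord 2)); first by exists (inord 2).
  by rewrite !andbF !addbF /= => -> /(_ isT).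
have Y'0 : Y' = set0.
  suff /Wi[_] : indep M Y' by apply.
  apply/Ci => // j; have [_ _ iC] := Cc j; apply: iC; rewrite properEneq subsetIr andbT.
  apply/eqP => e; have sCj : C j \subset Y'.
    by rewrite -e subsetIl.
  have cj : c j by apply/subsetP => x xj; move: (subsetP sCj _ xj); rewrite (inY' _ j) // => /andP[].
  have [_ /set0Pn[x xj] _] := Cm j; have := subsetP sCj _ xj.
  by rewrite (inY' _ j) // cj.
suff trace j : Y :&: C j \in W by split.
have -> : Y :&: C j = scale (c j) (C j); last by apply: scaleW => //; case: (Cm j).
apply/setP => x; rewrite inE in_scale andbC [in RHS]andbC.
case: (boolP (x \in C j)) => //= xj; have := inY' x j xj; rewrite Y'0 inE.
by have : c j -> x \in Y by [move/subsetP; apply]; case: (c j); case: (x \in Y) => // /(_ isT).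
Qed.

End Ears.

(** * One or two ears of three skew circuits *)

Section SkewTriples.
Variable T : finType.
Implicit Types (M N : matroid T) (W : {set {set T}}) (X Y Z C D P Q A B : {set T}).

Definition has_L_minor M : Prop :=
  exists N : matroid T, series_minor M N /\
    (miso N (cycle_matroid L1) \/ miso N (cycle_matroid L2) \/
     miso N (cycle_matroid L3) \/ miso N (cycle_matroid L4) \/
     miso N (cycle_matroid L5)).

Lemma comb_in W Bs l : sd_closed W -> {subset Bs <= W} -> comb Bs l \in W.
Proof.
move=> [W0 Wsd]; elim: Bs l => [|C Bs IHB] [|b l] sB; try by
  rewrite (_ : comb _ _ = set0) //; apply/setP => x; rewrite !inE.
rewrite (_ : comb _ _ = sd (scale b C) (comb Bs l)).
  apply: Wsd; first by apply: scaleW => //; apply: sB; rewrite mem_head.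
  by apply: IHB => D DB; apply: sB; rewrite inE DB orbT.
by apply/setP => x; rewrite !(in_sd, in_scale, inE).
Qed.

Lemma min_cycle_trace W C Y : min_cycle W C -> Y :&: C \in W -> Y :&: C = set0 \/ C \subset Y.
Proof.
by move=> [_ _ Cmin] YW; case: (Cmin _ YW (subsetIr _ _)) => [|/setIidPr]; [left | right].
Qed.

(** With [min_cycle_miss], this supplies the two kinds of elements on a circuit that is split by an
    ear. *)
Lemma min_cycle_meet W C D : set0 \in W -> D :&: C \notin W -> exists2 x, x \in C & x \in D.
Proof.
move=> W0 nW; have /set0Pn[x] : D :&: C != set0 by apply: contraNneq nW => ->.
by rewrite inE => /andP[]; exists x.
Qed.

Lemma min_cycle_miss W C D : min_cycle W C -> D :&: C \notin W -> exists2 x, x \in C & x \notin D.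
Proof.
move=> [CW _ _] nW; have /subsetPn[x] : ~~ (C \subset D); last by exists x.
by apply: contra nW => /setIidPr->.
Qed.

(** Each trace of [Y] on a circuit is empty or the whole circuit, so the coefficients can be read
    off from the traces. *)
Lemma skew_triple_span W C1 C2 C3 Y : skew_triple W C1 C2 C3 -> Y \in W ->
  Y \subset C1 :|: C2 :|: C3 -> exists c1 c2 c3, forall x,
    (x \in Y) = (c1 && (x \in C1)) (+) (c2 && (x \in C2)) (+) (c3 && (x \in C3)).
Proof.
move=> [m1 m2 m3 dis span] YW sY; have [Y1 Y2 Y3] := span _ YW sY.
have tr C : min_cycle W C -> Y :&: C \in W ->
    exists c : bool, forall x, (x \in C) ==> ((x \in Y) == c).
  move=> mC YC; have [Y0|sC] := min_cycle_trace mC YC.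
    by exists false => x; have := mem_eq x Y0; membership x.
  by exists true => x; have := mem_sub x sC; membership x.
have [[c1 e1] [c2 e2] [c3 e3]] := And3 (tr _ m1 Y1) (tr _ m2 Y2) (tr _ m3 Y3).
exists c1, c2, c3 => x; move: (dis x) (mem_sub x sY) (e1 x) (e2 x) (e3 x).
by case: c1 {e1}; case: c2 {e2}; case: c3 {e3}; membership x.
Qed.

(** Two vectors occur on each circuit and one off the circuits: these are the three parallel pairs
    and the single edge of [L1]. *)
Lemma one_ear_minor M W C1 C2 C3 D : cycle_space M W -> skew_triple W C1 C2 C3 ->
  ear W (C1 :|: C2 :|: C3) D ->
  D :&: C1 \notin W -> D :&: C2 \notin W -> D :&: C3 \notin W -> has_L_minor M.
Proof.
move=> MW st [DW Dspan] D1 D2 D3; have [m1 m2 m3 dis span] := st.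
have [[W0 Wsd] _ _] := MW.
have vE x : mem_vec [:: C1; C2; C3; D] x = [:: x \in C1; x \in C2; x \in C3; x \in D] by [].
have [[x1 x1C x1D] [x2 x2C x2D] [x3 x3C x3D]] :=
  And3 (min_cycle_meet W0 D1) (min_cycle_meet W0 D2) (min_cycle_meet W0 D3).
have [[y1 y1C y1D] [y2 y2C y2D] [y3 y3C y3D]] :=
  And3 (min_cycle_miss m1 D1) (min_cycle_miss m2 D2) (min_cycle_miss m3 D3).
(* Were [D] inside the circuits, skewness would make its trace on [C1] a cycle. *)
have [z zD zC] : exists2 z, z \in D & z \notin C1 :|: C2 :|: C3.
  by apply/subsetPn; apply: contra D1 => /(span _ DW)[].
suff [N [MN NL]] : exists N, series_minor M N /\ miso N (cycle_matroid L1).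
  by exists N; split=> //; left.
apply: (series_minor_graph (B := [:: C1; C2; C3; D]) MW L1_has_coords).
- move=> l _; apply: comb_in => // C; rewrite !inE.
  by case: m1 m2 m3 => [? _ _] [? _ _] [? _ _] /or4P[] /eqP->.
- move=> Y YW sY.
  have {}sY : Y \subset C1 :|: C2 :|: C3 :|: D.
    by apply/subsetP => x /sY; rewrite vE /= !inE orbF -!orbA.
  have [d sYd] : exists d, sd Y (scale d D) \subset C1 :|: C2 :|: C3.
    have [sYC|sYD] := Dspan _ YW sY; [exists false | by exists true].
    by apply/subsetP => x; have := mem_sub x sYC; membership x.
  have YdW : sd Y (scale d D) \in W by apply: Wsd => //; apply: scaleW.
  have [c1 [c2 [c3 cE]]] := skew_triple_span st YdW sYd.
  exists [:: c1; c2; c3; d] => //; apply/setP => x; have := cE x.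
  rewrite in_sd in_scale inE /=.
  by case: (x \in Y); case: (x \in C1); case: (x \in C2); case: (x \in C3); case: (x \in D);
    case: c1 {cE}; case: c2; case: c3; case: (d).
- move=> x; have := dis x; rewrite vE /=.
  by case: (x \in C1); case: (x \in C2); case: (x \in C3); case: (x \in D).
- suff /allP H : all (fun v => [exists y, mem_vec [:: C1; C2; C3; D] y == v]) L1_coords.
    by move=> v /H/existsP[y /eqP]; exists y.
  have v1 x : x \in C1 -> mem_vec [:: C1; C2; C3; D] x = [:: true; false; false; x \in D].
    by move=> xC; move: (dis x); rewrite vE xC; membership x.
  have v2 x : x \in C2 -> mem_vec [:: C1; C2; C3; D] x = [:: false; true; false; x \in D].
    by move=> xC; move: (dis x); rewrite vE xC; membership x.
  have v3 x : x \in C3 -> mem_vec [:: C1; C2; C3; D] x = [:: false; false; true; x \in D].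
    by move=> xC; move: (dis x); rewrite vE xC; membership x.
  have vz : mem_vec [:: C1; C2; C3; D] z = [:: false; false; false; true].
    by move: zC; rewrite vE zD; membership z.
  repeat (apply/andP; split); last by [].
  - by apply/existsP; exists y1; rewrite v1 // (negPf y1D).
  - by apply/existsP; exists x1; rewrite v1 // x1D.
  - by apply/existsP; exists y2; rewrite v2 // (negPf y2D).
  - by apply/existsP; exists x2; rewrite v2 // x2D.
  - by apply/existsP; exists y3; rewrite v3 // (negPf y3D).
  - by apply/existsP; exists x3; rewrite v3 // x3D.
  - by apply/existsP; exists z; rewrite vz.
Qed.

(* [two_ears W C1 C2 C3 A B]: A is an ear of C1, C2 avoiding C3, and B is an ear joining C3
   to the union of C1, C2 and A. *)
Record two_ears W C1 C2 C3 A B : Prop := TwoEars {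
  two_ears_inA : A \in W;
  two_ears_inB : B \in W;
  two_ears_A1 : A :&: C1 \notin W;
  two_ears_A2 : A :&: C2 \notin W;
  two_ears_A3 : A :&: C3 = set0;
  two_ears_B3 : B :&: C3 \notin W;
  two_ears_BQ : B :&: (C1 :|: C2 :|: A) \notin W;
  two_ears_A0 : ~~ (A \subset C1 :|: C2 :|: C3);
  two_ears_B0 : ~~ (B \subset C1 :|: C2 :|: C3 :|: A);
  two_ears_span : forall Y, Y \in W -> Y \subset C1 :|: C2 :|: C3 :|: A :|: B ->
    exists a b, sd Y (sd (scale a A) (scale b B)) \subset C1 :|: C2 :|: C3 }.

Lemma two_ears_sym W C1 C2 C3 A B : two_ears W C1 C2 C3 A B -> two_ears W C2 C1 C3 A B.
Proof. by move=> [? ? ? ? ? ? ? ? ? ?]; split=> //; rewrite (setUC C2). Qed.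

(** Used to normalise [B]. The cycle [D] misses [C3] and lies within [C1], [C2] and [A], so both
    traces of [B] that matter keep their status. *)
Lemma two_ears_shift W C1 C2 C3 A B D : sd_closed W -> skew_triple W C1 C2 C3 ->
  two_ears W C1 C2 C3 A B -> D \in W -> D = A \/ D \subset C1 :|: C2 ->
  two_ears W C1 C2 C3 A (sd B D).
Proof.
move=> [W0 Wsd] [_ _ _ dis _] [AW BW A1 A2 A3 B3 BQ A0 B0 span] DW DQ.
have sDQ : D \subset C1 :|: C2 :|: A.
  by case: DQ => [->|sD]; [apply: subsetUr | apply: subset_trans sD (subsetUl _ _)].
have D3 x : ~~ ((x \in D) && (x \in C3)).
  case: DQ => [->|sD]; first by have := mem_eq x A3; membership x.
  by have := mem_sub x sD; have := dis x; membership x.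
split=> //.
- exact: Wsd.
- by rewrite (_ : _ :&: _ = B :&: C3) //; apply/setP => x; have := D3 x; membership x.
- apply: contra BQ => sW; rewrite (_ : _ :&: _ = sd D (sd B D :&: (C1 :|: C2 :|: A))); first exact: Wsd.
  by apply/setP => x; have := mem_sub x sDQ; membership x.
- apply: contra B0 => sBD; apply/subsetP => x.
  by have := mem_sub x sDQ; have := mem_sub x sBD; membership x.
- move=> Y YW sY; have [|a [b sYZ]] := span _ YW.
    by apply/subsetP => x; have := mem_sub x sDQ; have := mem_sub x sY; membership x.
  case: DQ => [DA|sD].
    (* The ear B + A taken with coefficient [b] brings along [b] copies of [A], which the
       coefficient of [A] has to cancel. *)
    exists (a (+) b), b; apply/subsetP => x; have := mem_sub x sYZ; rewrite DA.
    by case: a {sYZ}; case: b; membership x.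
  exists a, b; apply/subsetP => x; have := mem_sub x sYZ; have := mem_sub x sD.
  by case: a {sYZ}; case: b; membership x.
Qed.

(** [pres] collects the vectors that occur, in any order, whereas [vecs] follows the edges of the
    graph. *)
Lemma two_ears_graph M W C1 C2 C3 A B s (vecs pres : seq bitseq) :
  cycle_space M W -> skew_triple W C1 C2 C3 -> two_ears W C1 C2 C3 A B ->
  has_coords 5 s vecs -> vecs =i pres ->
  (forall x, has id (mem_vec [:: C1; C2; C3; A; B] x) ->
     mem_vec [:: C1; C2; C3; A; B] x \in pres) ->
  (forall v, v \in pres -> exists x, mem_vec [:: C1; C2; C3; A; B] x = v) ->
  exists N, series_minor M N /\ miso N (cycle_matroid (mkgraph s)).
Proof.
move=> MW st te hc vp vecp presv; have [m1 m2 m3 dis _] := st.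
have [AW BW _ _ _ _ _ _ _ span] := te; have [[W0 Wsd] _ _] := MW.
apply: (series_minor_graph (B := [:: C1; C2; C3; A; B]) MW hc).
- move=> l _; apply: comb_in => // C; rewrite !inE.
  by case: m1 m2 m3 => [? _ _] [? _ _] [? _ _] /or4P[|||/orP[]] /eqP->.
- move=> Y YW sY.
  have {}sY : Y \subset C1 :|: C2 :|: C3 :|: A :|: B.
    by apply/subsetP => x /sY; rewrite /= !inE orbF -!orbA.
  have [a [b sYab]] := span _ YW sY.
  have YabW : sd Y (sd (scale a A) (scale b B)) \in W.
    by apply: (Wsd) => //; apply: (Wsd); apply: scaleW.
  have [c1 [c2 [c3 cE]]] := skew_triple_span st YabW sYab.
  exists [:: c1; c2; c3; a; b] => //; apply/setP => x; have := cE x.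
  rewrite !(in_sd, in_scale) inE /=; clear.
  case: (a && _); case: (b && _); case: (c1 && _); case: (c2 && _); case: (c3 && _);
  by case: (x \in Y).
- by move=> x; rewrite vp; apply: vecp.
- by move=> v; rewrite vp; apply: presv.
Qed.

Lemma mem_vec1 W C1 C2 C3 A B x : skew_triple W C1 C2 C3 -> x \in C1 ->
  mem_vec [:: C1; C2; C3; A; B] x = in1 (x \in A, x \in B).
Proof. by move=> [_ _ _ dis _] xC; move: (dis x); rewrite /mem_vec /= xC; membership x. Qed.

Lemma mem_vec2 W C1 C2 C3 A B x : skew_triple W C1 C2 C3 -> x \in C2 ->
  mem_vec [:: C1; C2; C3; A; B] x = in2 (x \in A, x \in B).
Proof. by move=> [_ _ _ dis _] xC; move: (dis x); rewrite /mem_vec /= xC; membership x. Qed.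

Lemma mem_vec3 W C1 C2 C3 A B x : skew_triple W C1 C2 C3 -> x \in C3 ->
  mem_vec [:: C1; C2; C3; A; B] x = in3 (x \in A, x \in B).
Proof. by move=> [_ _ _ dis _] xC; move: (dis x); rewrite /mem_vec /= xC; membership x. Qed.

Lemma mem_vec_out C1 C2 C3 A B x : x \notin C1 :|: C2 :|: C3 ->
  mem_vec [:: C1; C2; C3; A; B] x = out (x \in A, x \in B).
Proof. by rewrite /mem_vec /=; membership x. Qed.

(** Besides [y] and [z], a point of [B] off [A] and the circuits is available; the three points give
    the three edges at the vertex [n] of [L5]. *)
Lemma two_ears_L5 M W C1 C2 C3 A B z y :
  cycle_space M W -> skew_triple W C1 C2 C3 -> two_ears W C1 C2 C3 A B ->
  B :&: C1 = set0 -> sd B A :&: C2 = set0 ->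
  y \notin C1 :|: C2 :|: C3 -> y \in A -> y \notin B ->
  z \notin C1 :|: C2 :|: C3 -> z \in A -> z \in B ->
  has_L_minor M.
Proof.
move=> MW st te B1 BA2 yC yA yB zC zA zB; have [m1 m2 m3 dis skew] := st.
have [AW BW A1 A2 A3 B3 _ _ B0 _] := te; have [[W0 Wsd] _ _] := MW.
have [[x1 x1C x1A] [x2 x2C x2A] [x3 x3C x3B]] :=
  And3 (min_cycle_meet W0 A1) (min_cycle_meet W0 A2) (min_cycle_meet W0 B3).
have [[y1 y1C y1A] [y2 y2C y2A] [y3 y3C y3B]] :=
  And3 (min_cycle_miss m1 A1) (min_cycle_miss m2 A2) (min_cycle_miss m3 B3).
have /subsetPn[w wB] := B0; rewrite !inE negb_or => /andP[wC wA].
have {}wC : w \notin C1 :|: C2 :|: C3 by rewrite !inE.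
have b1 x : x \in C1 -> (x \in B) = false by move=> xC; have := mem_eq x B1; rewrite !inE xC andbT.
have b2 x : x \in C2 -> (x \in B) = (x \in A).
  by move=> xC; have := mem_eq x BA2; rewrite !(in_sd, inE) xC; membership x.
have a3 x : x \in C3 -> (x \in A) = false by move=> xC; have := mem_eq x A3; rewrite !inE xC andbT.
suff [N [MN NL]] : exists N, series_minor M N /\ miso N (cycle_matroid L5).
  by exists N; split=> //; do 4 right.
apply: (two_ears_graph MW st te L5_has_coords (pres := L5_coords)) => // [x|].
  have [xC|n1] := boolP (x \in C1); first by rewrite (mem_vec1 _ _ st) // b1 //; case: (x \in A).
  have [xC|n2] := boolP (x \in C2); first by rewrite (mem_vec2 _ _ st) // b2 //; case: (x \in A).
  have [xC|n3] := boolP (x \in C3); first by rewrite (mem_vec3 _ _ st) // a3 //; case: (x \in B).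
  rewrite mem_vec_out; last by rewrite !inE !negb_or n1 n2 n3.
  by case: (x \in A); case: (x \in B).
suff /allP H : all (fun v => [exists x, mem_vec [:: C1; C2; C3; A; B] x == v]) L5_coords.
  by move=> v /H/existsP[x /eqP]; exists x.
repeat (apply/andP; split); last by [].
- by apply/existsP; exists y1; rewrite (mem_vec1 _ _ st) // b1 // (negPf y1A).
- by apply/existsP; exists x1; rewrite (mem_vec1 _ _ st) // b1 // x1A.
- by apply/existsP; exists y2; rewrite (mem_vec2 _ _ st) // b2 // (negPf y2A).
- by apply/existsP; exists x2; rewrite (mem_vec2 _ _ st) // b2 // x2A.
- by apply/existsP; exists y3; rewrite (mem_vec3 _ _ st) // a3 // (negPf y3B).
- by apply/existsP; exists x3; rewrite (mem_vec3 _ _ st) // a3 // x3B.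
- by apply/existsP; exists y; rewrite mem_vec_out // yA (negPf yB).
- by apply/existsP; exists z; rewrite mem_vec_out // zA zB.
- by apply/existsP; exists w; rewrite mem_vec_out // wB (negPf wA).
Qed.

(** Only [A] splits [C2], only [B] splits [C3], and off the circuits the ears are disjoint. The
    graph thus depends only on which pairs of memberships in [A] and [B] occur on [C1], recorded by
    [h]. *)
Lemma two_ears_L234 M W C1 C2 C3 A B y :
  cycle_space M W -> skew_triple W C1 C2 C3 -> two_ears W C1 C2 C3 A B ->
  B :&: C1 \notin W -> B :&: C2 = set0 -> A :&: B \subset C1 :|: C2 :|: C3 ->
  y \notin C1 :|: C2 :|: C3 -> y \in A ->
  has_L_minor M.
Proof.
move=> MW st te B1 B2 AB yC yA; have [m1 m2 m3 dis skew] := st.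
have [AW BW A1 A2 A3 B3 _ _ B0 _] := te; have [[W0 Wsd] _ _] := MW.
have [[x1 x1C x1A] [x2 x2C x2A] [x3 x3C x3B]] :=
  And3 (min_cycle_meet W0 A1) (min_cycle_meet W0 A2) (min_cycle_meet W0 B3).
have [[y1 y1C y1A] [y2 y2C y2A] [y3 y3C y3B]] :=
  And3 (min_cycle_miss m1 A1) (min_cycle_miss m2 A2) (min_cycle_miss m3 B3).
have [x1' x1C' x1B] := min_cycle_meet W0 B1; have [y1' y1C' y1B] := min_cycle_miss m1 B1.
have /subsetPn[w wB] := B0; rewrite !inE negb_or => /andP[wC wA].
have {}wC : w \notin C1 :|: C2 :|: C3 by rewrite !inE.
have yB : y \notin B by have := mem_sub y AB; rewrite in_setI yA (negPf yC) implybF.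
have b2 x : x \in C2 -> (x \in B) = false by move=> xC; have := mem_eq x B2; rewrite !inE xC andbT.
have a3 x : x \in C3 -> (x \in A) = false by move=> xC; have := mem_eq x A3; rewrite !inE xC andbT.
pose h p := [exists x in C1, (x \in A, x \in B) == p].
have hP x : x \in C1 -> h (x \in A, x \in B) by move=> xC; apply/existsP; exists x; rewrite xC eqxx.
pose rest := [:: in2 (false, false); in2 (true, false); in3 (false, false); in3 (false, true);
                 out (true, false); out (false, true)].
pose squares := [:: (false, false); (false, true); (true, false); (true, true)].
pose pres := [seq in1 p | p <- squares & h p] ++ rest.
have graph s vecs : has_coords 5 s vecs -> vecs =i pres ->
    exists N, series_minor M N /\ miso N (cycle_matroid (mkgraph s)).
  move=> hc vp; apply: (two_ears_graph MW st te hc vp) => [x|].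
    rewrite mem_cat; have [xC|n1] := boolP (x \in C1).
      rewrite (mem_vec1 _ _ st) // map_f // mem_filter hP //.
      by case: (x \in A); case: (x \in B).
    have [xC|n2] := boolP (x \in C2).
      by rewrite orbC (mem_vec2 _ _ st) // b2 //; case: (x \in A).
    have [xC|n3] := boolP (x \in C3).
      by rewrite orbC (mem_vec3 _ _ st) // a3 //; case: (x \in B).
    have xC : x \notin C1 :|: C2 :|: C3 by rewrite !inE !negb_or n1 n2 n3.
    rewrite orbC mem_vec_out //; have := mem_sub x AB; rewrite in_setI (negPf xC) implybF /=.
    by case: (x \in A); case: (x \in B).
  move=> v; rewrite mem_cat => /orP[/mapP[p]|].
    rewrite mem_filter => /andP[/exists_inP[x xC /eqP <-] _] ->.
    by exists x; rewrite (mem_vec1 _ _ st).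
  suff /allP H : all (fun v => [exists x, mem_vec [:: C1; C2; C3; A; B] x == v]) rest.
    by move=> /H/existsP[x /eqP]; exists x.
  repeat (apply/andP; split); last by [].
  - by apply/existsP; exists y2; rewrite (mem_vec2 _ _ st) // b2 // (negPf y2A).
  - by apply/existsP; exists x2; rewrite (mem_vec2 _ _ st) // b2 // x2A.
  - by apply/existsP; exists y3; rewrite (mem_vec3 _ _ st) // a3 // (negPf y3B).
  - by apply/existsP; exists x3; rewrite (mem_vec3 _ _ st) // a3 // x3B.
  - by apply/existsP; exists y; rewrite mem_vec_out // yA (negPf yB).
  - by apply/existsP; exists w; rewrite mem_vec_out // wB (negPf wA).
have eqi (s t : seq bitseq) : all (mem s) t -> all (mem t) s -> s =i t.
  by move=> /allP st' /allP ts v; apply/idP/idP; [apply: ts | apply: st'].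
have g2 p : L2_coords p =i pres -> has_L_minor M.
  by move=> /(graph _ _ (L2_has_coords p))[N [MN NL]]; exists N; split=> //; right; left.
have g3 p : L3_coords p =i pres -> has_L_minor M.
  by move=> /(graph _ _ (L3_has_coords p))[N [MN NL]]; exists N; split=> //; do 2 right; left.
have g4 : L4_coords =i pres -> has_L_minor M.
  by move=> /(graph _ _ L4_has_coords)[N [MN NL]]; exists N; split=> //; do 3 right; left.
have := hP _ x1C; have := hP _ y1C; have := hP _ x1C'; have := hP _ y1C'.
rewrite x1A x1B (negPf y1A) (negPf y1B) {hP graph}.
(* Forgets one coordinate of a known pair: since [A] and [B] both split [C1], either coordinate
   takes both values there. *)
have hx (f : bool -> bool * bool) b : h (f b) -> h (f false) || h (f true).
  by case: b => ->; rewrite ?orbT.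
move=> /(hx (fun b => (b, false))) k1 /(hx (fun b => (b, true))) k2.
move=> /(hx (fun b => (false, b))) k3 /(hx (fun b => (true, b))) k4.
move: k1 k2 k3 k4; rewrite /pres /squares /= in g2 g3 g4 *.
(* Of the sixteen patterns seven survive: all four pairs, any three, or two opposite ones. *)
case: (h (false, false)) g2 g3 g4; case: (h (false, true)); case: (h (true, false));
  case: (h (true, true)) => //= g2 g3 g4 _ _ _ _.
- by apply: g4; apply: eqi.
- by apply: (g3 (false, false)); apply: eqi.
- by apply: (g3 (false, true)); apply: eqi.
- by apply: (g3 (true, false)); apply: eqi.
- by apply: (g2 (false, false)); apply: eqi.
- by apply: (g3 (true, true)); apply: eqi.
- by apply: (g2 (false, true)); apply: eqi.
Qed.

(** The point [x] of [A] rules out cycles that use [A] within the circuits and [B], so [B] alone is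
    an ear of the three circuits, and it splits all of them. *)
Lemma two_ears_both M W C1 C2 C3 A B x :
  cycle_space M W -> skew_triple W C1 C2 C3 -> two_ears W C1 C2 C3 A B ->
  B :&: C1 \notin W -> B :&: C2 \notin W ->
  x \notin C1 :|: C2 :|: C3 -> x \in A -> x \notin B -> has_L_minor M.
Proof.
move=> MW st te B1 B2 xC xA xB; have [AW BW _ _ _ B3 _ _ _ span] := te.
apply: (one_ear_minor MW st (D := B)) => //; split=> // Y YW sY.
have [|a [b sYab]] := span _ YW.
  by apply/subsetP => z; have := mem_sub z sY; membership z.
have a0 : a = false.
  move: (mem_sub x sYab) (mem_sub x sY) xC; rewrite !(in_sd, in_scale, inE) xA (negPf xB).
  by case: (a) => //; rewrite andbF; membership x.
case: b sYab => sYab; [right | left]; apply/subsetP => z; have := mem_sub z sYab;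
  rewrite a0; membership z.
Qed.

Lemma two_ears_clear M W C1 C2 C3 A B :
  cycle_space M W -> skew_triple W C1 C2 C3 -> two_ears W C1 C2 C3 A B -> B :&: C2 \in W ->
  exists B', [/\ two_ears W C1 C2 C3 A B', B' :&: C2 = set0 &
                 forall x, x \notin C2 -> (x \in B') = (x \in B)].
Proof.
move=> MW st te B2; have [_ m2 _ dis _] := st; have [Wsd _ _] := MW.
have [B0|sC] := min_cycle_trace m2 B2; first by exists B.
exists (sd B C2); split.
- by apply: two_ears_shift => //; [case: m2 | right; apply: subsetUr].
- by apply/setP => x; have := mem_sub x sC; membership x.
- by move=> x; membership x.
Qed.

Lemma two_ears_minor M W C1 C2 C3 A B :
  cycle_space M W -> skew_triple W C1 C2 C3 -> two_ears W C1 C2 C3 A B -> has_L_minor M.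
Proof.
move=> MW st te; have [Wsd _ _] := MW; have [W0 sdW] := Wsd.
(* A point of [A] off the circuits lies outside [B] or outside A + B; [B] is replaced
   accordingly. *)
wlog [y yC /andP[yA yB]] : B te /
    exists2 y, y \notin C1 :|: C2 :|: C3 & (y \in A) && (y \notin B).
  move=> IH; have AW := two_ears_inA te.
  have [y yA yC] := subsetPn (two_ears_A0 te).
  have [yB|yB] := boolP (y \in B); last by apply: (IH B) => //; exists y; rewrite ?yA.
  apply: (IH (sd B A)); first by apply: two_ears_shift => //; left.
  by exists y; rewrite // in_sd yA yB.
have [AB|/subsetPn[z]] := boolP (A :&: B \subset C1 :|: C2 :|: C3).
  have one (D1 D2 : {set T}) : skew_triple W D1 D2 C3 -> two_ears W D1 D2 C3 A B ->
      A :&: B \subset D1 :|: D2 :|: C3 -> y \notin D1 :|: D2 :|: C3 ->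
      B :&: D1 \notin W -> B :&: D2 \in W -> has_L_minor M.
    move=> stD teD sAB yD B1 B2; have [B' [te' B'2 B'E]] := two_ears_clear MW stD teD B2.
    have [_ _ _ dis _] := stD.
    have {}B'E x : (x \notin D2) ==> ((x \in B') == (x \in B)).
      by apply/implyP => /B'E->.
    apply: (two_ears_L234 MW stD te' _ B'2 _ yD yA).
      rewrite (_ : _ :&: _ = B :&: D1) //; apply/setP => x.
      by move: (dis x) (B'E x); membership x.
    by apply/subsetP => x; move: (mem_sub x sAB) (B'E x); membership x.
  have [B1|B1] := boolP (B :&: C1 \in W); have [B2|B2] := boolP (B :&: C2 \in W).
  (* Off the circuits the ears are disjoint, so the trace of [B] on [C1], [C2] and [A] is the sum of
     its traces on [C1] and [C2]; these cannot both be cycles. *)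
  - case/negP: (two_ears_BQ te); rewrite (_ : _ :&: _ = sd (B :&: C1) (B :&: C2)); first exact: sdW.
    have [_ _ _ dis _] := st; apply/setP => x.
    by move: (dis x) (mem_sub x AB) (mem_eq x (two_ears_A3 te)); membership x.
  - by apply: (one C2 C1) => //; rewrite ?(setUC C2) //;
      [apply: skew_triple_swap12 | apply: two_ears_sym].
  - exact: (one C1 C2).
  - exact: (two_ears_both MW st te B1 B2 yC yA yB).
(* With [z] in both ears, [B] and A + B are interchangeable: [y] is in [A] but not in [B], and [z]
   is in [A] but not in A + B. Either ear gives [L1] if it splits both [C1] and [C2]. *)
rewrite inE => /andP[zA zB] zC.
have teBA : two_ears W C1 C2 C3 A (sd B A).
  by apply: two_ears_shift => //; [apply: two_ears_inA te | left].
have zBA : z \notin sd B A by rewrite in_sd zA zB.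
(* On a circuit that [A] splits, at least one of [B] and A + B splits it too, since their sum is
   [A]. *)
have notboth (C : {set T}) : A :&: C \notin W -> B :&: C \in W -> sd B A :&: C \notin W.
  move=> nA inB; apply: contra nA => inBA.
  rewrite (_ : _ :&: _ = sd (B :&: C) (sd B A :&: C)); first exact: sdW.
  by apply/setP => x; membership x.
(* The case where [B] does not split one circuit and A + B does not split the other; adding whole
   circuits to [B] makes both traces empty, which is the pattern of [L5]. *)
have joined (D1 D2 : {set T}) : skew_triple W D1 D2 C3 -> two_ears W D1 D2 C3 A B ->
    y \notin D1 :|: D2 :|: C3 -> z \notin D1 :|: D2 :|: C3 ->
    B :&: D1 \in W -> sd B A :&: D2 \in W -> has_L_minor M.
  move=> stD teD yD zD B1 BA2; have [_ m2 _ dis _] := stD.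
  have [B' [/two_ears_sym te' B'1 B'E]] :=
    two_ears_clear MW (skew_triple_swap12 stD) (two_ears_sym teD) B1.
  have E2 x : (x \in D2) ==> ((x \in B') == (x \in B)).
    by apply/implyP => xD; apply/eqP/B'E; move: (dis x); rewrite xD; membership x.
  have nD1 x : x \notin D1 :|: D2 :|: C3 -> x \notin D1 by membership x.
  have nD2 x : x \notin D1 :|: D2 :|: C3 -> x \notin D2 by membership x.
  have [BA0|sD2] := min_cycle_trace m2 BA2.
    apply: (two_ears_L5 MW stD te' B'1 _ yD yA _ zD zA); rewrite ?B'E ?nD1 //.
    by apply/setP => x; move: (mem_eq x BA0) (E2 x); membership x.
  have te2 : two_ears W D1 D2 C3 A (sd B' D2).
    by apply: two_ears_shift => //; [case: m2 | right; apply: subsetUr].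
  apply: (two_ears_L5 MW stD te2 _ _ yD yA _ zD zA).
  - by apply/setP => x; move: (dis x) (mem_eq x B'1); membership x.
  - by apply/setP => x; move: (mem_sub x sD2) (E2 x); membership x.
  - by rewrite in_sd B'E ?nD1 // (negPf yB) (negPf (nD2 _ yD)).
  - by rewrite in_sd B'E ?nD1 // zB (negPf (nD2 _ zD)).
have [B1|B1] := boolP (B :&: C1 \in W); last first.
  have [B2|B2] := boolP (B :&: C2 \in W); last exact: (two_ears_both MW st te B1 B2 yC yA yB).
  have BA2 := notboth _ (two_ears_A2 te) B2.
  have [BA1|BA1] := boolP (sd B A :&: C1 \in W); last exact: (two_ears_both MW st teBA BA1 BA2 zC zA zBA).
  by apply: (joined C2 C1) => //; rewrite ?(setUC C2) //;
      [apply: skew_triple_swap12 | apply: two_ears_sym].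
have BA1 := notboth _ (two_ears_A1 te) B1.
have [BA2|BA2] := boolP (sd B A :&: C2 \in W); last exact: (two_ears_both MW st teBA BA1 BA2 zC zA zBA).
exact: (joined C1 C2).
Qed.

Lemma second_ear_minor M W C1 C2 C3 A :
  cycle_space M W -> mconnected M -> skew_triple W C1 C2 C3 ->
  ear W (C1 :|: C2 :|: C3) A -> A :&: C1 \notin W -> A :&: C2 \notin W -> A :&: C3 \in W ->
  has_L_minor M.
Proof.
move=> MW conn st; have [m1 m2 m3 dis skew] := st; have [[W0 sdW] Wg _] := MW.
have [[C1W _ _] [C2W _ _] [C3W C3n _]] := And3 m1 m2 m3.
(* The trace on [C3] is a cycle, and adding it to [A] changes nothing outside [C3]. *)
wlog A3 : A / A :&: C3 = set0.
  move=> IH [AW earA] A1 A2 A3.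
  have trE C : (forall x, ~~ ((x \in C) && (x \in C3))) -> sd A (A :&: C3) :&: C = A :&: C.
    by move=> d; apply/setP => x; have := d x; membership x.
  apply: (IH (sd A (A :&: C3))).
  - by apply/setP => x; membership x.
  - split=> [|Y YW sY]; first exact: sdW.
    have [|sYC|sYA] := earA _ YW; [|by left|right].
      by apply/subsetP => x; have := mem_sub x sY; membership x.
    by apply/subsetP => x; have := mem_sub x sYA; membership x.
  - by rewrite trE // => x; have := dis x; membership x.
  - by rewrite trE // => x; have := dis x; membership x.
  - by rewrite (_ : _ :&: _ = set0) //; apply/setP => x; membership x.
move=> [AW earA] A1 A2 _.
have A0 : ~~ (A \subset C1 :|: C2 :|: C3) by apply: contra A1 => /(skew _ AW)[].
(* As [A] misses [C3], adding [A] to a cycle does not change its trace on [C3]; so [C3] is skew to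
   the union of [C1], [C2] and [A]. *)
have skew3 Y : Y \in W -> Y \subset C1 :|: C2 :|: C3 :|: A -> Y :&: C3 \in W.
  move=> YW sY; have [sYC|sYA] := earA _ YW sY; first by have [] := skew _ YW sYC.
  have [_ _] := skew _ (sdW _ _ YW AW) sYA.
  rewrite (_ : _ :&: _ = Y :&: C3) //; apply/setP => x.
  by move: (mem_eq x A3); membership x.
have ZA : C3 :|: (C1 :|: C2 :|: A) = C1 :|: C2 :|: C3 :|: A by rewrite setUC setUAC.
have [||||||B [[BW earB] B3 BQ]] := connected_ear (P := C3) (Q := C1 :|: C2 :|: A) MW conn.
- rewrite disjoints_subset; apply/subsetP => x.
  by move: (dis x) (mem_eq x A3); membership x.
- by move=> Y YW; rewrite ZA; apply: skew3.
- exact: Wg.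
- by rewrite !subUset !Wg.
- exact: C3n.
- by apply: contraNneq A1 => /setP Q0; rewrite (_ : _ :&: _ = set0) //; apply/setP => x;
    move: (Q0 x); membership x.
rewrite ZA in earB.
apply: (two_ears_minor MW st (A := A) (B := B)); split=> //.
  by apply: contra B3; apply: skew3.
move=> Y YW sY; have [b sYb] : exists b, sd Y (scale b B) \subset C1 :|: C2 :|: C3 :|: A.
  have [sYC|sYB] := earB _ YW sY; [exists false | by exists true].
  by apply/subsetP => x; have := mem_sub x sYC; membership x.
have YbW : sd Y (scale b B) \in W by apply: sdW => //; apply: scaleW.
(* [B] was removed first, so that what remains is a cycle to which the ear property of [A]
   applies. *)
have [sYC|sYA] := earA _ YbW sYb; [exists false, b | exists true, b]; apply/subsetP => x.
  by have := mem_sub x sYC; case: b {sYb YbW sYC}; membership x.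
by have := mem_sub x sYA; case: b {sYb YbW sYA}; membership x.
Qed.

Lemma skew_triple_minor M W C1 C2 C3 :
  cycle_space M W -> mconnected M -> skew_triple W C1 C2 C3 -> has_L_minor M.
Proof.
move=> MW conn st; have [m1 m2 m3 dis skew] := st; have [[W0 sdW] Wg _] := MW.
have [[C1W C1n _] [C2W C2n _] [C3W _ _]] := And3 m1 m2 m3.
have [||||||A [earA A1 A23]] := connected_ear (P := C1) (Q := C2 :|: C3) MW conn.
- by rewrite disjoints_subset; apply/subsetP => x; move: (dis x); membership x.
- by move=> Y YW; rewrite setUA => /(skew _ YW)[].
- exact: Wg.
- by rewrite subUset !Wg.
- exact: C1n.
- by have /set0Pn[x xC] := C2n; apply/set0Pn; exists x; rewrite inE xC.
rewrite setUA in earA.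
(* The trace of [A] on the union of [C2] and [C3] is the sum of its traces on the two circuits, so
   at least one of them is not a cycle. *)
have [A2|A2] := boolP (A :&: C2 \in W); have [A3|A3] := boolP (A :&: C3 \in W).
- case/negP: A23; rewrite (_ : _ :&: _ = sd (A :&: C2) (A :&: C3)); first exact: sdW.
  by apply/setP => x; move: (dis x); membership x.
- rewrite setUAC in earA.
  exact: second_ear_minor MW conn (skew_triple_swap23 st) earA A1 A3 A2.
- exact: second_ear_minor MW conn st earA A1 A2 A3.
- exact: one_ear_minor MW st earA A1 A2 A3.
Qed.

End SkewTriples.

Theorem theorem1p4 (T : finType) (M : matroid T) :
  is_matroid M -> binary M -> mconnected M -> has_skew_circuits M 3 ->
  exists N : matroid T, series_minor M N /\
    (miso N (cycle_matroid L1) \/ miso N (cycle_matroid L2) \/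
     miso N (cycle_matroid L3) \/ miso N (cycle_matroid L4) \/
     miso N (cycle_matroid L5)).
Proof.
move=> isM binM conn skewM; have [W MW] := binary_cycle_space isM binM.
have [C1 [C2 [C3 st]]] := has_skew_triple MW skewM.
exact: skew_triple_minor MW conn st.
Qed.
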